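(* Let $H$ be a graph with at least one edge. There exists $\overline{r}_H<1$ such that the constant graphon $W\equiv r$ uniquely minimizes $\mathsf{LT}(H,r)$ whenever $\overline{r}_H\le r\le1$. If $H$ is non-bipartite, then there exists $\underline{r}_H>0$ such that $W\equiv r$ does not minimize $\mathsf{LT}(H,r)$ for $0\le r<\underline{r}_H$.
   Context: Graphs are finite and simple; $V(H),E(H)$ are the vertex and edge sets and $e(H)=|E(H)|$. A graphon is a symmetric measurable function $W\colon[0,1]^2\to[0,1]$, and $t(H,W):=\int_{[0,1]^{V(H)}}\prod_{ij\in E(H)}W(x_i,x_j)\prod_{i\in V(H)}dx_i$. For a function $f$, write $\mathbb{E}[f(W)]:=\int_{[0,1]^2}f(W(x,y))\,dx\,dy$. Let $h(x):=x\log x-x+1$ for $x\in[0,1]$ (with $h(0)=1$). For $0\le r\le1$, $\mathsf{LT}(H,r)$ denotes the variational problem (and also its value): minimize $\mathbb{E}[h(W)]$ over all graphons $W$ subject to $t(H,W)\le r^{e(H)}$. Graphons are identified if they differ on a set of measure zero or by a measure-preserving transformation of $[0,1]$; uniqueness of minimizers is understood up to this identification. *)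

(* Defs.v *)
From HB Require Import structures.
From mathcomp Require Import all_boot all_order all_algebra.
From mathcomp Require Import all_classical all_reals all_analysis.

Set Implicit Arguments.
Unset Strict Implicit.
Unset Printing Implicit Defensive.

Import Order.TTheory GRing.Theory Num.Theory.
Import numFieldNormedType.Exports.

Local Open Scope classical_set_scope.
Local Open Scope ring_scope.
Local Open Scope ereal_scope.

Record sgraph := SGraph {
  vertex :> finType;
  adj : rel vertex;
  adj_sym : symmetric adj;
  adj_irrefl : irreflexive adj
}.

(* Each unordered edge is represented by exactly one ordered pair: the one
   listing its endpoints in the enumeration order of the vertex set. *)
Definition edges (H : sgraph) : {set H * H} :=
  [set p : H * H | adj p.1 p.2 && (enum_rank p.1 < enum_rank p.2)%N].

Definition num_edges (H : sgraph) : nat := #|edges H|.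

Definition bipartite (H : sgraph) : Prop :=
  exists c : H -> bool, forall u v : H, adj u v -> c u != c v.

(* Lebesgue measure on [0,1], as a probability on R carried by [0,1]. *)
Definition unit_leb (R : realType) : probability (measurableTypeR R) R :=
  uniform_prob (@ltr01 R).

Section unit_cube.
Context (R : realType).
Local Notation TR := (measurableTypeR R).

Definition tuple_cons (n : nat) (p : TR * n.-tuple TR) : n.+1.-tuple TR :=
  [the n.+1.-tuple TR of p.1 :: p.2].

Lemma measurable_tuple_cons (n : nat) :
  measurable_fun [set: TR * n.-tuple TR] (@tuple_cons n).
Proof. exact: measurable_cons. Qed.

HB.instance Definition _ (n : nat) :=
  isMeasurableFun.Build _ _ _ _ (@tuple_cons n) (@measurable_tuple_cons n).

(* The n-fold product of [unit_leb], that is, Lebesgue measure on [0,1]^n. *)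
Fixpoint unit_cube (n : nat) : probability (n.-tuple TR) R :=
  match n with
  | 0 => \d_([tuple] : 0.-tuple TR)
  | m.+1 => distribution (unit_leb R \x unit_cube m) (@tuple_cons m)
  end.

End unit_cube.

(* A graphon on [0,1]^2 is represented by an extension to R^2; since every
   integral below is against products of [unit_leb] and graphons are identified
   almost everywhere, the values outside [0,1]^2 are immaterial. *)
Record graphon (R : realType) := Graphon {
  graphon_fun :> measurableTypeR R * measurableTypeR R -> R;
  graphon_measurable : measurable_fun setT graphon_fun;
  graphon_sym : forall x y, graphon_fun (x, y) = graphon_fun (y, x);
  graphon_range : forall z, (0 <= graphon_fun z <= 1)%R
}.

Definition const_graphon (R : realType) (r : R) (r01 : (0 <= r <= 1)%R) :
    graphon R :=
  @Graphon R (cst r) (@measurable_cst _ _ _ _ _ r) (fun _ _ => erefl)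
    (fun=> r01).

(* The coordinate x_v of x in [0,1]^{V(H)} is [tnth x (enum_rank v)]. *)
Definition hom_density (R : realType) (H : sgraph) (W : graphon R) : \bar R :=
  \int[unit_cube R #|H|]_x
    (\prod_(e in edges H)
       W (tnth x (enum_rank e.1), tnth x (enum_rank e.2)))%:E.

(* As [ln 0 = 0], this gives h 0 = 1. *)
Definition h (R : realType) (x : R) : R := (x * ln x - x + 1)%R.

Definition graphon_mean (R : realType) (f : R -> R) (W : graphon R) : \bar R :=
  \int[unit_leb R \x unit_leb R]_z (f (W z))%:E.

Definition measure_preserving (R : realType)
    (phi : measurableTypeR R -> measurableTypeR R) : Prop :=
  [/\ measurable_fun setT phi,
      {homo phi : x / (0 <= x <= 1)%R} &
      forall A : set (measurableTypeR R), measurable A ->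
        unit_leb R (phi @^-1` A) = unit_leb R A].

(* The equivalence relation generated by almost-everywhere equality and by
   pull-back along measure-preserving transformations. *)
Inductive identified (R : realType) : graphon R -> graphon R -> Prop :=
| identified_ae (U W : graphon R) :
    {ae unit_leb R \x unit_leb R, forall z, U z = W z} -> identified U W
| identified_pullback (U W : graphon R)
    (phi : measurableTypeR R -> measurableTypeR R) :
    measure_preserving phi ->
    (forall x y, U (x, y) = W (phi x, phi y)) -> identified U W
| identified_sym (U W : graphon R) : identified U W -> identified W U
| identified_trans (U V W : graphon R) :
    identified U V -> identified V W -> identified U W.

Definition feasible (R : realType) (H : sgraph) (r : R) (W : graphon R) : Prop :=
  hom_density H W <= (r ^+ num_edges H)%:E.

Definition minimizes_LT (R : realType) (H : sgraph) (r : R) (W : graphon R) :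
    Prop :=
  feasible H r W /\
  forall W' : graphon R, feasible H r W' ->
    graphon_mean (@h R) W <= graphon_mean (@h R) W'.

Definition uniquely_minimizes_LT (R : realType) (H : sgraph) (r : R)
    (W : graphon R) : Prop :=
  minimizes_LT H r W /\
  forall W' : graphon R, minimizes_LT H r W' -> identified W' W.

(* Main.v *)
Require Import Defs.
From mathcomp Require Import all_boot all_order all_algebra.
From mathcomp Require Import all_classical all_reals all_analysis.
From mathcomp Require Import measurable_realfun.
From mathcomp Require Import ring lra.

(** Write [e] for the number of edges of [H] and put
    [mu = - ln r / r ^+ (e - 1)], [c = 1/4], [v = max w c] and
    [phi w = r ^+ e * (ln v - ln r) - (v - w)].

    For [r] close to 1 the proof is a Lagrange multiplier argument made
    pointwise.  Two inequalities carry it.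

    - For any numbers [w_i] in [0, 1], one for each edge,
      [r ^+ e + \sum_i phi (w_i) <= \prod_i w_i]
      ([prod_ge_sum_edge_minorant]).  Raising each [w_i] to [v_i = max w_i c]
      increases the product by at most [\sum_i (v_i - w_i)], because all
      factors lie in [0, 1]; and the raised product is
      [r ^+ e * expR (\sum_i (ln v_i - ln r))], which [1 + x <= expR x] bounds
      from below.
    - For [w] in [0, 1], [h r <= h w + mu * phi w], with equality only at
      [w = r] ([h_ge_edge_minorant]).  The value of [mu] is the one for which
      both sides have the same derivative at [w = r].

    An edge of [H] joins two distinct vertices, so the pair of coordinates
    attached to it is uniform on the unit square
    ([integral_unit_cube_pair]).  Integrating the first inequality gives
    [r ^+ e + e * E[phi W] <= t(H, W)], whence [E[phi W] <= 0] for every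
    feasible [W].  Integrating the second gives
    [h r <= E[h W] + mu * E[phi W] <= E[h W]].  When [E[h W] = h r], the second
    inequality is an equality almost everywhere, so [W = r] almost everywhere.

    The cutoff [c] is what lets the logarithm be used: [ln w] alone is
    unbounded below and [r ^+ e * (ln w - ln r)] would violate the second
    inequality near [w = 0].  For [r] near 1 the multiplier [mu] is small, and
    the entropy gained by lowering [w] below [c], at rate at least
    [- ln c], outweighs the linear loss at rate [mu].

    When [H] is not bipartite, the graphon of the complete bipartite graph
    between two halves of [0, 1] has [t(H, W) = 0], hence is feasible, and has
    [E[h W] = 1/2], whereas [h r] tends to 1 as [r] tends to 0. *)

Set Implicit Arguments.
Unset Strict Implicit.
Unset Printing Implicit Defensive.

Import Order.TTheory GRing.Theory Num.Theory.

Local Open Scope ring_scope.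

(** * Logarithm and entropy inequalities *)

Section logarithm.
Context {R : realType}.
Implicit Types r w y c : R.

Lemma ln_le_sub1 y : 0 < y -> ln y <= y - 1.
Proof.
move=> y0; have := @le_ln1Dx R (y - 1); rewrite [1 + _]addrC subrK; apply.
by rewrite ltrBrDl subrr.
Qed.

Lemma ln_ge_1subV y : 0 < y -> 1 - y^-1 <= ln y.
Proof.
move=> y0; have := @ln_le_sub1 y^-1; rewrite invr_gt0 => /(_ y0).
by rewrite lnV ?posrE//; lra.
Qed.

(** Applying [1 - 1/s <= ln s] to [s = sqrt y] yields
    [(s - 1) ^+ 2 <= y * ln y - y + 1], which has the right order at [y = 1];
    from [1 - 1/y <= ln y] only [0 <= y * ln y - y + 1] would follow. *)
Lemma ln_ge_1subVsqrt y : 0 < y -> 2 * (1 - (Num.sqrt y)^-1) <= ln y.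
Proof.
move=> y0; have s0 : 0 < Num.sqrt y by rewrite sqrtr_gt0.
rewrite -{2}(sqr_sqrtr (ltW y0)) lnXn// -[ln _ *+ 2]mulr_natl.
by rewrite ler_pM2l// ln_ge_1subV.
Qed.

(** Both [y * ln y - y + 1] and [y - 1 - ln y] vanish to second order at
    [y = 1], so away from 0 the former dominates a small multiple of the latter.
    With [s = sqrt y], the difference is at least
    [(s - 1) ^+ 2 * (1 - eps * (1 + 2 / s))], and [s >= 1/2] makes
    [1 + 2 / s <= 5]. *)
Lemma entropy_gt_log y eps : 1/4 <= y -> y != 1 -> 0 <= eps -> eps < 1/5 ->
  eps * (y - 1 - ln y) < y * ln y - y + 1.
Proof.
move=> y4 y1 eps0 eps5; have y0 : 0 < y by lra.
have := ln_ge_1subVsqrt y0; set s := Num.sqrt y => lns.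
have s0 : 0 < s by rewrite sqrtr_gt0.
have ys : y = s ^+ 2 by rewrite sqr_sqrtr// ltW.
have s2 : 1/2 <= s.
  rewrite leNgt; apply/negP => s2; suff : s ^+ 2 < 1/4 by lra.
  by rewrite expr2; nra.
have s1 : s != 1 by apply: contra_neq y1 => s1; rewrite ys s1 expr1n.
have sV2 : s^-1 <= 2.
  by rewrite -[2]invrK lef_pV2 ?posrE ?invr_gt0//; lra.
have sq0 : 0 < (s - 1) ^+ 2 by rewrite exprn_even_gt0// subr_eq0.
rewrite -subr_gt0.
have -> : y * ln y - y + 1 - eps * (y - 1 - ln y) =
    (s - 1) ^+ 2 * (1 - eps * (1 + 2 * s^-1)) +
    (y + eps) * (ln y - 2 * (1 - s^-1)).
  by rewrite ys; field; rewrite gt_eqF.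
apply: ltr_wpDr; first by apply: mulr_ge0; lra.
apply: mulr_gt0 => //; nra.
Qed.

(** As [ln c] is the derivative of [h] at [c], this is convexity of [h]; at
    [w = 0] it relies on the convention [ln 0 = 0]. *)
Lemma h_ge_tangent c w : 0 < c -> 0 <= w -> h c + ln c * (w - c) <= h w.
Proof.
move=> c0; rewrite /h le_eqVlt => /predU1P[<-|w0]; first by lra.
have := @ln_ge_1subV (w / c); rewrite divr_gt0// => /(_ isT).
rewrite ln_div ?posrE// invf_div => /(ler_wpM2l (ltW w0)).
have -> : w * (1 - c / w) = w - c by field; rewrite gt_eqF.
by lra.
Qed.

Lemma h_ge0 w : 0 <= w -> 0 <= h w.
Proof.
by move=> w0; have := h_ge_tangent ltr01 w0; rewrite /h ln1; lra.
Qed.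

Lemma h_at0 : h 0 = 1 :> R.
Proof. by rewrite /h mul0r subrr add0r. Qed.

Lemma h_at1 : h 1 = 0 :> R.
Proof. by rewrite /h ln1 mulr0 sub0r addNr. Qed.

(** With [s = sqrt r], [h r >= 1 - 2 * s + s ^+ 2], and [s < 1/8]. *)
Lemma h_gt_half r : 0 <= r -> r < 1/64 -> 1/2 < h r.
Proof.
rewrite le_eqVlt => /predU1P[<- _|r0 r64]; first by rewrite /h; lra.
have := ln_ge_1subVsqrt r0; set s := Num.sqrt r => lns.
have s0 : 0 < s by rewrite sqrtr_gt0.
have rs : r = s ^+ 2 by rewrite sqr_sqrtr// ltW.
have s8 : s < 1/8.
  rewrite ltNge; apply/negP => s8; suff : 1/64 <= r by lra.
  by rewrite rs expr2; nra.
have : r * (2 * (1 - s^-1)) <= r * ln r by rewrite ler_pM2l.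
have -> : r * (2 * (1 - s^-1)) = 2 * r - 2 * s by rewrite rs; field; rewrite gt_eqF.
by rewrite /h; lra.
Qed.

End logarithm.

(** * Separable lower bounds for products *)

Section product_minorant.
Context {R : realType} {I : Type}.
Implicit Types (s : seq I) (v w : I -> R).

Lemma prodB_le_sumB s v w :
    (forall i, 0 <= w i <= v i) -> (forall i, v i <= 1) ->
  \prod_(i <- s) v i - \prod_(i <- s) w i <= \sum_(i <- s) (v i - w i).
Proof.
move=> wv v1; elim: s => [|i s IH]; first by rewrite !big_nil subrr.
rewrite !big_cons; set P := \prod_(j <- s) v j in IH *.
set Q := \prod_(j <- s) w j in IH *; set S := \sum_(j <- s) _ in IH *.
have S0 : 0 <= S by apply: sumr_ge0 => j _; have := wv j; lra.
have P1 : P <= 1.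
  by apply: prodr_ile1 => j _; rewrite v1 andbT; have := wv j; lra.
have -> : v i * P - w i * Q = w i * (P - Q) + (v i - w i) * P by ring.
rewrite addrC; have := wv i; have := v1 i => vi1 /andP[wi0 wvi].
by apply: lerD; nra.
Qed.

Lemma prod_ge_sum_ln s v (r : R) : 0 < r -> (forall i, 0 < v i) ->
  r ^+ size s * (1 + \sum_(i <- s) (ln (v i) - ln r)) <= \prod_(i <- s) v i.
Proof.
move=> r0 v0; have -> : \prod_(i <- s) v i =
    r ^+ size s * expR (\sum_(i <- s) (ln (v i) - ln r)).
  elim: s => [|i s IH]; first by rewrite !big_nil expR0 mulr1.
  rewrite !big_cons IH expRD expRB !lnK ?posrE//= exprS.
  by field; rewrite gt_eqF.
by rewrite ler_pM2l ?exprn_gt0// expR_ge1Dx.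
Qed.

End product_minorant.

(** The function [phi] with which [r ^+ n + \sum_i phi (w_i)] bounds a product
    of [n] factors from below. Its term in [ln] makes the bound tangent to the
    product at [w_i = r], and its last term pays for cutting [w] off at [c]. *)
Definition edge_minorant {R : realType} (n : nat) (r c w : R) : R :=
  r ^+ n * (ln (Num.max w c) - ln r) - (Num.max w c - w).

Section edge_minorant.
Context {R : realType}.
Implicit Types r c w : R.

Lemma prod_ge_sum_edge_minorant {I : Type} (s : seq I) (w : I -> R) r c :
    0 < r -> 0 < c <= 1 -> (forall i, 0 <= w i <= 1) ->
  r ^+ size s + \sum_(i <- s) edge_minorant (size s) r c (w i)
    <= \prod_(i <- s) w i.
Proof.
move=> r0 /andP[c0 c1] w01; pose v i := Num.max (w i) c.
have wv i : w i <= v i by rewrite le_max lexx.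
have v1 i : v i <= 1 by rewrite ge_max c1 andbT; case/andP: (w01 i).
have v0 i : 0 < v i by rewrite lt_max c0 orbT.
have wv0 i : 0 <= w i <= v i by rewrite wv andbT; case/andP: (w01 i).
have tele := prodB_le_sumB s wv0 v1; have prod_ln := prod_ge_sum_ln s r0 v0.
have -> : \sum_(i <- s) edge_minorant (size s) r c (w i) =
    r ^+ size s * (\sum_(i <- s) (ln (v i) - ln r)) - \sum_(i <- s) (v i - w i).
  by rewrite mulr_sumr -sumrB.
by lra.
Qed.

(** A uniform lower bound, so that a constant added to [edge_minorant] allows
    its integrals to be treated as integrals of nonnegative functions. *)
Lemma edge_minorant_ge n r c w : 0 < r <= 1 -> 0 < c <= 1 -> 0 <= w ->
  0 <= edge_minorant n r c w + (c - ln c).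
Proof.
move=> /andP[r0 r1] /andP[c0 c1] w0; rewrite /edge_minorant.
have lr : ln r <= 0 by rewrite ln_le0.
have lc : ln c <= 0 by rewrite ln_le0.
have lv : ln c <= ln (Num.max w c).
  by rewrite ler_ln ?posrE ?lt_max ?c0 ?orbT// le_max lexx orbT.
have rn0 : 0 <= r ^+ n by rewrite exprn_ge0// ltW.
have rn1 : r ^+ n <= 1 by rewrite exprn_ile1// ltW.
have vw : Num.max w c - w <= c by rewrite lerBlDr ge_max; apply/andP; split; lra.
suff : ln c <= r ^+ n * (ln (Num.max w c) - ln r) by lra.
by nra.
Qed.

Lemma measurable_edge_minorant n r c :
  measurable_fun [set: R] (edge_minorant n r c).
Proof.
rewrite /edge_minorant; apply: measurable_funB.
  apply: measurable_funM => //; apply: measurable_funB => //.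
  apply: measurableT_comp; first exact: measurable_ln.
  exact: measurable_maxr.
by apply: measurable_funB => //; exact: measurable_maxr.
Qed.

Lemma measurable_h : measurable_fun [set: R] (@h R).
Proof.
rewrite /h; apply: measurable_funD => //; apply: measurable_funB => //.
by apply: measurable_funM => //; exact: measurable_ln.
Qed.

(** The cutoff is handled in two steps, through [v = max w (1/4)]. Passing from
    [w] to [v] uses the tangent to [h] at [1/4], whose slope [ln (1/4)] is at
    most [- 3/4 <= - mu]. For [v], dividing by [r] and setting [y = v / r]
    turns the inequality into [entropy_gt_log] with [eps = - ln r]. *)
Lemma h_ge_edge_minorant n r w :
    1/4 < r <= 1 -> - ln r < 1/5 -> - ln r / r ^+ n <= 3/4 ->
    0 <= w ->
  h r <= h w + - ln r / r ^+ n * edge_minorant n.+1 r (1/4) w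
   ?= iff (w == r).
Proof.
move=> /andP[r4 r1] r5 mu34 w0; have r0 : 0 < r by lra.
have lr0 : ln r <= 0 by rewrite ln_le0.
have rn0 : 0 < r ^+ n by rewrite exprn_gt0.
set mu := - ln r / r ^+ n; have mu_r : mu * r ^+ n.+1 = - (r * ln r).
  by rewrite exprS /mu; field; rewrite gt_eqF.
have mu0 : 0 <= mu by rewrite divr_ge0 ?oppr_ge0// ltW.
rewrite /edge_minorant; set v := Num.max w (1/4).
have v4 : 1/4 <= v by rewrite le_max lexx orbT.
have v0 : 0 < v by lra.
rewrite [mu * _](_ : _ = - (r * ln r) * (ln v - ln r) - mu * (v - w)); last first.
  by rewrite -mu_r; ring.
have step_v : v != r -> h r < h v + - (r * ln r) * (ln v - ln r).
  move=> vr; have vr4 : 1/4 <= v / r.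
    by rewrite ler_pdivlMr//; nra.
  have vr1 : v / r != 1.
    by apply: contra_neq vr => vr1; rewrite -[LHS](@divfK _ r) ?gt_eqF// vr1 mul1r.
  have := @entropy_gt_log R (v / r) (- ln r) vr4 vr1.
  rewrite oppr_ge0 => /(_ lr0 r5); rewrite ln_div ?posrE// -subr_gt0.
  rewrite -(pmulr_rgt0 _ r0) => gap; rewrite -subr_gt0 /h.
  by congr (0 < _): gap; field; rewrite gt_eqF.
have step_w : h v <= h w - mu * (v - w).
  rewrite /v; case: (leP w (1/4)) => [w4|w4]; last by rewrite subrr mulr0 subr0.
  have := @h_ge_tangent R (1/4) w; rewrite divr_gt0// => /(_ isT w0).
  have := @ln_le_sub1 R (1/4); rewrite divr_gt0// => /(_ isT) ln4.
  have : mu * (1/4 - w) <= - ln (1/4) * (1/4 - w).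
    by apply: ler_wpM2r; [lra | apply: le_trans mu34 _; lra].
  by lra.
have [wr|wr] := eqVneq w r.
  have vr : v = r by rewrite /v wr max_l// ltW.
  by rewrite vr wr !subrr !mulr0 subr0 addr0; exact: leif_refl.
suff lt_hr : h r < h w + (- (r * ln r) * (ln v - ln r) - mu * (v - w)).
  by split; [exact: ltW | rewrite lt_eqF].
have vr : v != r.
  by move: wr; rewrite /v; case: (leP w (1/4)) => // _ _; rewrite lt_eqF.
have := step_v vr; lra.
Qed.

End edge_minorant.

(** * Marginals of the unit cube *)

Section marginals.
Context {R : realType}.
Local Notation TR := (measurableTypeR R).
Local Open Scope ereal_scope.

Lemma integral_probability_cst d (T : measurableType d) (P : probability T R)
    (c : \bar R) :
  \int[P]_x c = c.
Proof.
rewrite -[RHS]mule1 -(probability_setT P); exact: integral_cst.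
Qed.

Lemma integral_unit_cubeS n (G : n.+1.-tuple TR -> \bar R) :
    measurable_fun setT G -> (forall x, 0 <= G x) ->
  \int[unit_cube R n.+1]_x G x =
  \int[unit_leb R]_y \int[unit_cube R n]_t G (tuple_cons (y, t)).
Proof.
move=> mG G0; rewrite /= ge0_integral_distribution//.
rewrite fubini_tonelli1//; last by move=> ?; exact: G0.
by apply: (measurableT_comp mG); exact: measurable_tuple_cons.
Qed.

Lemma integral_unit_cube_coord n (i : 'I_n) (G : TR -> \bar R) :
    measurable_fun setT G -> (forall x, 0 <= G x) ->
  \int[unit_cube R n]_x G (tnth x i) = \int[unit_leb R]_y G y.
Proof.
move=> mG G0; elim: n i => [|n IH] i; first by case: i.
rewrite integral_unit_cubeS//; last first.
  by apply: (measurableT_comp mG); exact: measurable_tnth.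
have [j ->|->] := unliftP ord0 i.
  under eq_integral do under eq_integral do rewrite tnthS.
  under eq_integral do rewrite IH.
  exact: integral_probability_cst.
by apply: eq_integral => y _; exact: (integral_probability_cst _ (G y)).
Qed.

(** Distinct coordinates are independent and uniform. The order
    [i < j] is the one in which [edges] lists the endpoints of an edge. *)
Lemma integral_unit_cube_pair n (i j : 'I_n) (F : TR * TR -> \bar R) :
    (i < j)%N -> measurable_fun setT F -> (forall z, 0 <= F z) ->
  \int[unit_cube R n]_x F (tnth x i, tnth x j) =
  \int[unit_leb R \x unit_leb R]_z F z.
Proof.
move=> ij mF F0; elim: n i j ij => [|n IH] i j ij; first by case: i ij.
rewrite integral_unit_cubeS//; last first.
  apply: (measurableT_comp mF).
  by apply: measurable_fun_pair; exact: measurable_tnth.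
have [j' jE|j0] := unliftP ord0 j; last by rewrite j0 in ij.
have [i' iE|i0] := unliftP ord0 i.
  rewrite iE jE in ij *.
  under eq_integral do under eq_integral do rewrite !tnthS.
  under eq_integral do rewrite IH//.
  exact: integral_probability_cst.
rewrite fubini_tonelli1// i0 jE; apply: eq_integral => y _.
under eq_integral do rewrite tnthS.
rewrite (@integral_unit_cube_coord _ _ (fun u => F (y, u)))//.
by apply: (measurableT_comp mF); exact: pair1_measurable.
Qed.

End marginals.

(** * Means over a graphon *)

Section graphon_mean.
Context {R : realType} (W : graphon R).
Implicit Types f g : R -> R.
Local Open Scope ereal_scope.

Lemma measurable_graphon_comp f : measurable_fun setT f ->
  measurable_fun setT (fun z => (f (W z))%:E).
Proof.
move=> mf; apply/measurable_EFinP.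
by apply: (measurableT_comp mf); exact: graphon_measurable.
Qed.

Lemma graphon_mean_ge0 f : (forall w, (0 <= w <= 1)%R -> (0 <= f w)%R) ->
  0 <= graphon_mean f W.
Proof.
move=> f0; apply: integral_ge0 => z _; rewrite lee_fin f0//.
exact: graphon_range.
Qed.

Lemma graphon_mean_cst (c : R) : graphon_mean (cst c) W = c%:E.
Proof. exact: (integral_probability_cst (unit_leb R \x unit_leb R) c%:E). Qed.

Lemma graphon_meanD f g :
    measurable_fun setT f -> (forall w, (0 <= w <= 1)%R -> (0 <= f w)%R) ->
    measurable_fun setT g -> (forall w, (0 <= w <= 1)%R -> (0 <= g w)%R) ->
  graphon_mean (fun w => f w + g w)%R W = graphon_mean f W + graphon_mean g W.
Proof.
move=> mf f0 mg g0; rewrite -ge0_integralD//.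
- by move=> z _; rewrite lee_fin f0// graphon_range.
- exact: measurable_graphon_comp.
- by move=> z _; rewrite lee_fin g0// graphon_range.
- exact: measurable_graphon_comp.
Qed.

Lemma graphon_meanZ (k : R) f :
    measurable_fun setT f -> (forall w, (0 <= w <= 1)%R -> (0 <= f w)%R) ->
    (0 <= k)%R ->
  graphon_mean (fun w => k * f w)%R W = k%:E * graphon_mean f W.
Proof.
move=> mf f0 k0; rewrite -ge0_integralZl_EFin//.
- by move=> z _; rewrite lee_fin f0// graphon_range.
- exact: measurable_graphon_comp.
Qed.

Lemma graphon_mean_eq0 f :
    measurable_fun setT f -> (forall w, (0 <= w <= 1)%R -> (0 <= f w)%R) ->
    graphon_mean f W = 0 ->
  {ae unit_leb R \x unit_leb R, forall z, f (W z) = 0%R}.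
Proof.
move=> mf f0 mean0.
have := ae_eq_integral_abs (unit_leb R \x unit_leb R) measurableT
  (measurable_graphon_comp mf).
rewrite (eq_integral (fun z => (f (W z))%:E)); last first.
  by move=> z _; rewrite gee0_abs// lee_fin f0// graphon_range.
move=> -[/(_ mean0) ae0 _].
by apply: filterS ae0 => z /(_ I) [].
Qed.

End graphon_mean.

(** * From a bound on products to a bound on homomorphism densities *)

Section hom_density.
Context {R : realType} (H : sgraph) (W : graphon R).
Local Notation TR := (measurableTypeR R).
Local Open Scope ereal_scope.

Let edge_coords (e : H * H) (x : #|H|.-tuple TR) :=
  (tnth x (enum_rank e.1), tnth x (enum_rank e.2)).

Let measurable_edge_coords e : measurable_fun setT (edge_coords e).
Proof. by apply: measurable_fun_pair; exact: measurable_tnth. Qed.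

Lemma integral_edge_coords e (f : R -> R) :
    e \in edges H -> measurable_fun setT f ->
    (forall w, (0 <= w <= 1)%R -> (0 <= f w)%R) ->
  \int[unit_cube R #|H|]_x (f (W (edge_coords e x)))%:E = graphon_mean f W.
Proof.
rewrite inE => /andP[_ lt_e] mf f0.
rewrite (@integral_unit_cube_pair _ _ _ _ (fun z => (f (W z))%:E))//.
  exact: measurable_graphon_comp.
by move=> z; rewrite lee_fin f0// graphon_range.
Qed.

(** If [a + \sum_e phi (w_e)] bounds products over the edges from below, then
    [t(H, W) <= a] forces [E[phi W] <= 0]. Adding [K] makes the integrands
    nonnegative. *)
Lemma graphon_mean_le_hom_density (phi : R -> R) (a K : R) :
    (0 < num_edges H)%N ->
    measurable_fun setT phi ->
    (forall w, (0 <= w <= 1)%R -> (0 <= phi w + K)%R) ->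
    (0 <= a)%R -> (0 <= K)%R ->
    (forall w : H * H -> R, (forall e, 0 <= w e <= 1)%R ->
       (a + \sum_(e in edges H) phi (w e) <= \prod_(e in edges H) w e)%R) ->
    hom_density H W <= a%:E ->
  graphon_mean (fun w => phi w + K)%R W <= K%:E.
Proof.
move=> e0 mphi phi0 a0 K0 phi_prod t_le.
set q := (fun w => (phi w + K)%R).
have mq : measurable_fun setT q by apply: measurable_funD.
have Wr := graphon_range W.
have mqe e : measurable_fun setT (fun x => (q (W (edge_coords e x)))%:E).
  apply/measurable_EFinP; apply: (measurableT_comp mq).
  apply: (measurableT_comp (graphon_measurable W)).
  exact: measurable_edge_coords.
have q0 e x : 0 <= (q (W (edge_coords e x)))%:E by rewrite lee_fin phi0.
have sum_mean : \int[unit_cube R #|H|]_x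
    (\sum_(e <- enum (edges H)) (q (W (edge_coords e x)))%:E) =
    (num_edges H)%:R%:E * graphon_mean q W.
  rewrite ge0_integral_sum//.
  rewrite (eq_big_seq (fun=> graphon_mean q W)); last first.
    by move=> e; rewrite mem_enum => eH; apply: integral_edge_coords.
  by rewrite big_enum /= sumr_const mule_natl.
have : a%:E + (num_edges H)%:R%:E * graphon_mean q W
    <= hom_density H W + ((num_edges H)%:R * K)%:E.
  have cst_int c : c%:E = \int[unit_cube R #|H|]_x c%:E.
    by rewrite integral_probability_cst.
  rewrite -sum_mean [X in X + _ <= _]cst_int.
  rewrite [X in _ <= _ + X]cst_int /hom_density.
  have m_sum : measurable_fun setT (fun x : #|H|.-tuple TR =>
      \sum_(e <- enum (edges H)) (q (W (edge_coords e x)))%:E).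
    by apply: emeasurable_sum => e; exact: mqe.
  have m_prod : measurable_fun setT (fun x : #|H|.-tuple TR =>
      (\prod_(e in edges H) W (edge_coords e x))%:E).
    apply/measurable_EFinP.
    under [X in measurable_fun _ X]eq_fun do rewrite -big_enum.
    apply: measurable_prod => e _.
    apply: (measurableT_comp (graphon_measurable W)).
    exact: measurable_edge_coords.
  have sum0 x : 0 <= \sum_(e <- enum (edges H)) (q (W (edge_coords e x)))%:E.
    by apply: sume_ge0.
  have prod0 x : 0 <= (\prod_(e in edges H) W (edge_coords e x))%:E.
    by rewrite lee_fin; apply: prodr_ge0 => e _; case/andP: (Wr (edge_coords e x)).
  have eK0 : (0 <= (num_edges H)%:R * K)%R by apply: mulr_ge0.
  rewrite -!ge0_integralD//; last by move=> x _; exact: prod0.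
  apply: ge0_le_integral => //.
  - by move=> x _; apply: adde_ge0.
  - by apply: emeasurable_funD.
  - by apply: emeasurable_funD.
  move=> x _; rewrite sumEFin -!EFinD lee_fin big_split /= big_enum /=.
  rewrite big_enum /= sumr_const -[(K *+ _)%R]mulr_natl addrA.
  by rewrite lerD2r; apply: phi_prod => e; exact: Wr.
move=> /le_trans /(_ (leeD2r _ t_le)).
by rewrite leeD2lE// EFinM lee_pmul2l// lte_fin ltr0n.
Qed.

End hom_density.

(** * Constant graphons *)

Section const_graphon.
Context {R : realType} (H : sgraph) (r : R) (r01 : 0 <= r <= 1).

Lemma graphon_mean_const_graphon (f : R -> R) :
  graphon_mean f (const_graphon r01) = (f r)%:E.
Proof.
exact: (integral_probability_cst (unit_leb R \x unit_leb R)%E (f r)%:E).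
Qed.

Lemma feasible_const_graphon : feasible H r (const_graphon r01).
Proof.
rewrite /feasible /hom_density /=.
under eq_integral do rewrite prodr_const.
by rewrite (integral_probability_cst (unit_cube R #|H|)).
Qed.

End const_graphon.

(** * Optimality of the constant graphon near 1 *)

Section near_one.
Context {R : realType} (H : sgraph) (n : nat) (r : R).
Context (num_edgesH : num_edges H = n.+1) (r_gt : 1/4 < r) (r_le1 : r <= 1).
Context (ln_r : - ln r < 1/5).
Let mu := - ln r / r ^+ n.
Context (mu_le : mu <= 3/4).

(** The pointwise slack of the Lagrangian inequality; its mean measures how far
    a feasible graphon is from the constant [r]. *)
Definition deficit (w : R) : R :=
  h w + mu * edge_minorant n.+1 r (1/4) w - h r.

Let r_gt0 : 0 < r. Proof. by move: r_gt; lra. Qed.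

Let mu_ge0 : 0 <= mu.
Proof. by rewrite divr_ge0 ?oppr_ge0 ?ln_le0// exprn_ge0// ltW. Qed.

Lemma deficit_ge0 w : 0 <= w <= 1 -> 0 <= deficit w.
Proof.
move=> /andP[w0 _]; rewrite subr_ge0.
by apply: (h_ge_edge_minorant _ ln_r mu_le w0).1; rewrite r_gt.
Qed.

Lemma deficit_eq0 w : 0 <= w -> deficit w = 0 -> w = r.
Proof.
move=> w0 /eqP; rewrite subr_eq0 eq_sym.
have r01 : 1/4 < r <= 1 by rewrite r_gt.
by rewrite (h_ge_edge_minorant r01 ln_r mu_le w0).2 => /eqP.
Qed.

Lemma measurable_deficit : measurable_fun [set: R] deficit.
Proof.
apply: measurable_funB => //; apply: measurable_funD; first exact: measurable_h.
by apply: measurable_funM => //; exact: measurable_edge_minorant.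
Qed.

Local Open Scope ereal_scope.

(** Keeping the mean of [deficit] on the left makes this give uniqueness as well
    as optimality. *)
Lemma graphon_mean_h_ge (W : graphon R) : feasible H r W ->
  (h r)%:E + graphon_mean deficit W <= graphon_mean (@h R) W.
Proof.
move=> feasW; have r01 : (0 < r <= 1)%R by rewrite r_gt0.
have c01 : (0 < (1/4 : R) <= 1)%R by apply/andP; split; lra.
pose K : R := (1/4 - ln (1/4))%R.
pose q w : R := (edge_minorant n.+1 r (1/4) w + K)%R.
have K0 : (0 <= K)%R.
  have : (ln (1/4) <= 0 :> R)%R by rewrite ln_le0//; lra.
  by rewrite /K; lra.
have q0 w : (0 <= w <= 1)%R -> (0 <= q w)%R.
  by move=> /andP[w0 _]; exact: edge_minorant_ge.
have mq : measurable_fun setT q.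
  by apply: measurable_funD => //; exact: measurable_edge_minorant.
have q_le : graphon_mean q W <= K%:E.
  apply: (@graphon_mean_le_hom_density _ H W _ (r ^+ n.+1)) => //.
  - by rewrite num_edgesH.
  - exact: measurable_edge_minorant.
  - by rewrite exprn_ge0// ltW.
  - move=> w w01; rewrite -!big_enum /=.
    have size_e : size (enum (edges H)) = n.+1 by rewrite -cardE -num_edgesH.
    by rewrite -size_e; exact: prod_ge_sum_edge_minorant.
  - by rewrite -num_edgesH.
have h0 (w : R) : (0 <= w <= 1)%R -> (0 <= h w)%R by case/andP=> w0 _; exact: h_ge0.
have c0 : (0 <= h r + mu * K)%R.
  by apply: addr_ge0; [exact: h_ge0 (ltW r_gt0) | exact: mulr_ge0].
have balance : graphon_mean (@h R) W + mu%:E * graphon_mean q W =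
    graphon_mean deficit W + (h r + mu * K)%:E.
  rewrite -graphon_meanZ// -(graphon_mean_cst W (h r + mu * K)%R).
  rewrite -!graphon_meanD//.
  - by congr (graphon_mean _ W); apply/funext => w; rewrite /q /deficit /cst; ring.
  - exact: measurable_deficit.
  - exact: deficit_ge0.
  - exact: measurable_h.
  - by apply: measurable_funM.
  - by move=> w w01; apply: mulr_ge0 => //; exact: q0.
have : graphon_mean deficit W + (h r + mu * K)%:E
    <= graphon_mean (@h R) W + (mu * K)%:E.
  by rewrite -balance (EFinM mu K) leeD2l// lee_wpmul2l// lee_fin.
by rewrite EFinD addeA leeD2rE// addeC.
Qed.

(** A competitor with [E[h W] <= h r] has a nonnegative [deficit] of mean 0,
    so [W] equals [r] almost everywhere. *)
Lemma uniquely_minimizes_const_graphon (r01 : (0 <= r <= 1)%R) :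
  uniquely_minimizes_LT H r (const_graphon r01).
Proof.
have mean_deficit0 W : 0 <= graphon_mean deficit W.
  by apply: graphon_mean_ge0 => w; exact: deficit_ge0.
split; first split; first exact: feasible_const_graphon.
  move=> W /graphon_mean_h_ge; rewrite graphon_mean_const_graphon.
  by apply: le_trans; rewrite leeDl.
move=> W [feasW /(_ _ (feasible_const_graphon H r01))].
rewrite graphon_mean_const_graphon => /(le_trans (graphon_mean_h_ge feasW)).
rewrite -[leRHS]adde0 leeD2lE// => mean_le0.
apply: identified_ae.
have := @graphon_mean_eq0 R W deficit measurable_deficit deficit_ge0.
have -> : graphon_mean deficit W = 0 by apply/eqP; rewrite eq_le mean_le0 mean_deficit0.
move=> /(_ erefl); apply: filterS => z; apply: deficit_eq0.
by case/andP: (graphon_range W z).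
Qed.

End near_one.

(** * The bipartite graphon *)

Section bipartite_graphon.
Context {R : realType}.
Local Notation TR := (measurableTypeR R).

Definition left_half : set TR := `]-oo, (1/2)%R[%classic.

Lemma measurable_left_half : measurable left_half.
Proof. exact: measurable_itv. Qed.

Lemma unit_leb_left_half : unit_leb R left_half = (1/2)%:E.
Proof.
have mA := measurable_left_half.
have := integral_indic (unit_leb R) measurableT mA; rewrite setIT => <-.
rewrite integral_uniform//; last first.
  by apply/measurable_EFinP; exact: measurable_indic.
rewrite integral_indic//= subr0 invr1 mul1e.
have -> : (left_half `&` `[0, 1] = `[0, 1/2[)%classic.
  apply/seteqP; split => x /=; rewrite /left_half /= !in_itv /=.
    by move=> [-> /andP[->]].
  by move=> /andP[-> x2]; rewrite x2; split=> //; lra.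
rewrite lebesgue_measure_itv/= lte_fin ifT; last by lra.
by rewrite -EFinD subr0.
Qed.

(** The distance between two indicators is 1 exactly when they differ; this form
    is visibly symmetric and measurable. *)
Definition bipartite_fun (z : TR * TR) : R :=
  `|\1_left_half z.1 - \1_left_half z.2|.

Lemma measurable_bipartite_fun : measurable_fun setT bipartite_fun.
Proof.
apply: measurableT_comp => //.
have mA := measurable_left_half.
by apply: measurable_funB; apply: measurableT_comp => //; exact: measurable_indic.
Qed.

Lemma bipartite_fun_sym x y : bipartite_fun (x, y) = bipartite_fun (y, x).
Proof. by rewrite /bipartite_fun distrC. Qed.

Lemma bipartite_fun_range z : 0 <= bipartite_fun z <= 1.
Proof.
rewrite /bipartite_fun !indicE.
by do 2 case: (_ \in _); rewrite ?subrr ?subr0 ?sub0r ?normrN ?normr0 ?normr1 ?lexx ?ler01.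
Qed.

Definition bipartite_graphon : graphon R :=
  Graphon measurable_bipartite_fun bipartite_fun_sym bipartite_fun_range.

(** A point of the cube with nonzero integrand would 2-colour [H] by telling
    which coordinates lie in the left half. *)
Lemma hom_density_bipartite_graphon (H : sgraph) : ~ bipartite H ->
  hom_density H bipartite_graphon = 0%E.
Proof.
move=> nbip; rewrite /hom_density; apply: integral0_eq => x _.
pose side (v : H) := tnth x (enum_rank v) \in left_half.
have [e eH side_e] : exists2 e, e \in edges H & side e.1 = side e.2.
  apply: contrapT => no_e; apply: nbip; exists side => u v uv.
  apply/eqP => side_uv; apply: no_e.
  have := ltngtP (enum_rank u) (enum_rank v); case=> [lt|gt|eq].
  - by exists (u, v) => //; rewrite inE uv.
  - by exists (v, u) => //; rewrite inE /= (adj_sym v u) uv.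
  - move: uv; rewrite (enum_rank_inj (val_inj eq)) adj_irrefl//.
congr EFin; apply/eqP; rewrite prodf_seq_eq0; apply/hasP; exists e.
  exact: mem_index_enum.
rewrite eH /= /bipartite_fun !indicE /=.
by move: side_e; rewrite /side => ->; rewrite subrr normr0.
Qed.

Lemma graphon_mean_h_bipartite_graphon :
  graphon_mean (@h R) bipartite_graphon = (1/2)%:E.
Proof.
have mA := measurable_left_half.
rewrite /graphon_mean fubini_tonelli1//; last 2 first.
- exact: measurable_graphon_comp measurable_h.
- move=> z; rewrite lee_fin; apply: h_ge0.
  by case/andP: (graphon_range bipartite_graphon z).
rewrite -[RHS](integral_probability_cst (unit_leb R)).
apply: eq_integral => x _; rewrite /fubini_F /= /bipartite_fun /=.
have [xA|xA] := boolP (x \in left_half).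
  rewrite -unit_leb_left_half -[X in unit_leb R X]setIT -integral_indic//.
  apply: eq_integral => y _; rewrite !indicE xA.
  by case: (y \in left_half); rewrite /= ?subrr ?subr0 ?normr0 ?normr1 ?h_at0 ?h_at1.
have PAC : unit_leb R (~` left_half)%classic = (1/2)%:E.
  rewrite probability_setC// unit_leb_left_half -EFinB; congr EFin; lra.
rewrite -PAC -[X in unit_leb R X]setIT -integral_indic//; last exact: measurableC.
apply: eq_integral => y _; rewrite !indicE in_setC (negbTE xA).
by case: (y \in left_half); rewrite /= ?subrr ?sub0r ?normrN ?normr0 ?normr1 ?h_at0 ?h_at1.
Qed.

End bipartite_graphon.

(** * The theorem *)

Lemma not_minimizes_const_graphon (R : realType) (H : sgraph) (r : R)
    (r01 : 0 <= r <= 1) : ~ bipartite H -> r < 1/64 ->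
  ~ minimizes_LT H r (const_graphon r01).
Proof.
move=> nbip r64 [_ /(_ bipartite_graphon)].
have r0 : 0 <= r by case/andP: r01.
rewrite graphon_mean_const_graphon graphon_mean_h_bipartite_graphon.
rewrite /feasible hom_density_bipartite_graphon// !lee_fin exprn_ge0// => /(_ isT).
by rewrite leNgt h_gt_half.
Qed.

Lemma bernoulli_le_expr {R : realType} (n : nat) (r : R) : 0 <= r ->
  1 - n%:R * (1 - r) <= r ^+ n.
Proof.
move=> r0; elim: n => [|n IH]; first by rewrite mul0r subr0.
rewrite exprS; apply: le_trans (ler_wpM2l r0 IH).
have : 0 <= n%:R * (1 - r) ^+ 2 by rewrite mulr_ge0// sqr_ge0.
by rewrite -natr1 expr2; lra.
Qed.

Theorem theorem2p7 (R : realType) (H : sgraph) (H_edge : (0 < num_edges H)%N) :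
  (exists2 rbar : R, rbar < 1 &
     forall (r : R) (r01 : 0 <= r <= 1), rbar <= r ->
       uniquely_minimizes_LT H r (const_graphon r01)) /\
  (~ bipartite H ->
   exists2 rlow : R, 0 < rlow &
     forall (r : R) (r01 : 0 <= r <= 1), r < rlow ->
       ~ minimizes_LT H r (const_graphon r01)).
Proof.
split; last first.
  move=> nbip; exists (1/64); first lra.
  by move=> r r01; exact: not_minimizes_const_graphon.
case num_edgesH : (num_edges H) H_edge => [//|n] _.
(* At this distance from 1, [r] and [r ^+ n] are both at least 19/20. *)
exists (1 - (20 * n.+1%:R)^-1).
  by rewrite ltrBlDr ltrDl invr_gt0 mulr_gt0.
move=> r r01 rbar_le.
have n0 : 0 <= n%:R :> R by rewrite ler0n.
have nd : n.+1%:R * (1 - r) <= 1/20.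
  have : 1 - r <= (20 * n.+1%:R)^-1 by rewrite lerBlDr -lerBlDl.
  by rewrite -[(_ * _)^-1]mulr1 ler_pdivlMl ?mulr_gt0//; lra.
have [r0 r1] := andP r01.
have rn : 1 - n%:R * (1 - r) <= r ^+ n by exact: bernoulli_le_expr.
rewrite -natr1 in nd.
have r19 : 19/20 <= r by nra.
have ln_r : - ln r <= 1/19.
  have r0' : 0 < r by lra.
  have := ln_ge_1subV r0'; have : r^-1 <= 20/19.
    by rewrite -[r^-1]mul1r ler_pdivrMr//; lra.
  by lra.
apply: (@uniquely_minimizes_const_graphon _ _ n) => //; try lra.
by rewrite ler_pdivrMr; nra.
Qed.
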